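(* Let $R$ be a ring and let $\{M_i\}_{i\in I}$ be a collection of $R$-modules. If $\bigoplus_{i\in I}M_i$ is a cl.Hilbert module, then each $M_i$ $(i\in I)$ is a cl.Hilbert module.
   Context: All rings are commutative with identity $1\neq 0$ and all modules are unital. A proper submodule $P$ of an $R$-module $M$ is classical prime if for all $a,b\in R$ and $m\in M$, $abm\in P$ implies $am\in P$ or $bm\in P$. An $R$-module $M$ is a cl.Hilbert module (classical Hilbert module) if every classical prime submodule of $M$ is an intersection of maximal submodules of $M$. *)

(* Defs.v *)
From HB Require Import structures.
From mathcomp Require Import all_boot all_algebra.
From mathcomp Require Import all_classical.

Set Implicit Arguments.
Unset Strict Implicit.
Unset Printing Implicit Defensive.

Import GRing.Theory.
Local Open Scope classical_set_scope.
Local Open Scope ring_scope.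

Section DirectProduct.
Variables (R : comNzRingType) (I : Type) (M : I -> lmodType R).

(* An alias of the dependent function type, to carry the pointwise R-module
   structure; the library only provides it for non-dependent functions. *)
Definition direct_product : Type := forall i, M i.

HB.instance Definition _ := Choice.copy direct_product (forall i, M i).

Implicit Types f g h : direct_product.

Definition direct_product_zero : direct_product := fun=> 0.
Definition direct_product_opp f : direct_product := fun i => - f i.
Definition direct_product_add f g : direct_product := fun i => f i + g i.
Definition direct_product_scale (a : R) f : direct_product :=
  fun i => a *: f i.

Fact direct_product_addA : associative direct_product_add.
Proof. by move=> f g h; apply: functional_extensionality_dep => i; apply: addrA. Qed.

Fact direct_product_addC : commutative direct_product_add.
Proof. by move=> f g; apply: functional_extensionality_dep => i; apply: addrC. Qed.

Fact direct_product_add0 : left_id direct_product_zero direct_product_add.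
Proof. by move=> f; apply: functional_extensionality_dep => i; apply: add0r. Qed.

Fact direct_product_addN :
  left_inverse direct_product_zero direct_product_opp direct_product_add.
Proof. by move=> f; apply: functional_extensionality_dep => i; apply: addNr. Qed.

HB.instance Definition _ := GRing.isZmodule.Build direct_product
  direct_product_addA direct_product_addC direct_product_add0
  direct_product_addN.

Fact direct_product_scaleA (a b : R) f :
  direct_product_scale a (direct_product_scale b f)
  = direct_product_scale (a * b) f.
Proof. by apply: functional_extensionality_dep => i; apply: scalerA. Qed.

Fact direct_product_scale1 : left_id 1 direct_product_scale.
Proof. by move=> f; apply: functional_extensionality_dep => i; apply: scale1r. Qed.

Fact direct_product_scaleDr : right_distributive direct_product_scale +%R.
Proof. by move=> a f g; apply: functional_extensionality_dep => i; apply: scalerDr. Qed.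

Fact direct_product_scaleDl f :
  {morph direct_product_scale^~ f : a b / a + b}.
Proof. by move=> a b; apply: functional_extensionality_dep => i; apply: scalerDl. Qed.

HB.instance Definition _ := GRing.Zmodule_isLmodule.Build R direct_product
  direct_product_scaleA direct_product_scale1 direct_product_scaleDr
  direct_product_scaleDl.

Definition finitely_supported : {pred direct_product} :=
  fun f => `[< finite_set [set i | f i <> 0] >].

Fact finitely_supported_submod_closed : submod_closed finitely_supported.
Proof.
split=> [|a f g /asboolP fin_f /asboolP fin_g]; apply/asboolP.
  by apply: (@sub_finite_set _ _ set0) => [i /=|]; [|exact: finite_set0].
apply: (@sub_finite_set _ _ ([set i | f i <> 0] `|` [set i | g i <> 0])).
  move=> i /= afg_neq0; apply: contrapT => /not_orP[/contrapT fi0 /contrapT gi0].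
  apply: afg_neq0; change (a *: f i + g i = 0).
  by rewrite fi0 gi0 scaler0 addr0.
by rewrite finite_setU.
Qed.

HB.instance Definition _ := GRing.isSubmodClosed.Build R direct_product
  finitely_supported finitely_supported_submod_closed.

Record direct_sum : Type := DirectSum {
  direct_sum_val : direct_product;
  direct_sum_valP : direct_sum_val \in finitely_supported
}.

HB.instance Definition _ := [isSub for direct_sum_val].
HB.instance Definition _ := [Choice of direct_sum by <:].
HB.instance Definition _ := [SubChoice_isSubLmodule of direct_sum by <:].

End DirectProduct.

Section Submodules.
Variables (R : comNzRingType) (M : lmodType R).
Implicit Types N P K : set M.

Definition submodule N : Prop := submod_closed [in N].

Definition proper_submodule N : Prop := submodule N /\ N <> setT.

Definition maximal_submodule N : Prop :=
  proper_submodule N /\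
  forall K, submodule K -> N `<=` K -> K = N \/ K = setT.

Definition classical_prime P : Prop :=
  proper_submodule P /\
  forall (a b : R) (m : M), P ((a * b) *: m) -> P (a *: m) \/ P (b *: m).

Definition cl_Hilbert : Prop :=
  forall P, classical_prime P ->
  exists2 F : set (set M), (forall N, F N -> maximal_submodule N)
    & P = \bigcap_(N in F) N.

End Submodules.
Arguments cl_Hilbert {R} M.

(* Main.v *)
(** Every classical prime submodule of a homomorphic image pulls back to a
    classical prime submodule of the source, and taking preimages under a
    surjection identifies the (maximal) submodules of the image with the
    (maximal) submodules of the source that contain the kernel. Hence
    homomorphic images of cl.Hilbert modules are cl.Hilbert, in particular the
    images of a direct sum under its coordinate projections. *)
From HB Require Import structures.
Require Import Defs.
From mathcomp Require Import all_boot all_algebra.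
From mathcomp Require Import all_classical.

Set Implicit Arguments.
Unset Strict Implicit.
Unset Printing Implicit Defensive.

Import GRing.Theory.
Local Open Scope classical_set_scope.
Local Open Scope ring_scope.

(** Trades the boolean membership of [[in N]] for plain [Prop] membership in [N]. *)
Lemma submoduleP (R : comNzRingType) (M : lmodType R) (N : set M) :
  submodule N <-> N 0 /\ forall (a : R) u v, N u -> N v -> N (a *: u + v).
Proof.
split=> -[N0 Nlin]; split=> [|a u v].
- exact: set_mem N0.
- by move=> Nu Nv; apply/set_mem/Nlin; apply: mem_set.
- exact: mem_set.
- by move=> /set_mem Nu /set_mem Nv; apply/mem_set/Nlin.
Qed.

Section SurjectiveImage.
Variables (R : comNzRingType) (M L : lmodType R) (f : {linear M -> L}).
Hypothesis f_surj : forall y, exists x, f x = y.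
Implicit Types K P : set L.

Lemma submodule_preimage K : submodule (f @^-1` K) <-> submodule K.
Proof.
split=> /submoduleP[K0 Klin]; apply/submoduleP; split=> [|a u v].
- by rewrite -(linear0 f).
- have [x <-] := f_surj u; have [y <-] := f_surj v.
  by rewrite -linearP; apply: Klin.
- by rewrite /= linear0.
- by rewrite /= linearP; apply: Klin.
Qed.

Lemma preimage_surj_inj K P : f @^-1` K = f @^-1` P -> K = P.
Proof.
move=> eqKP; apply/seteqP; split=> y; have [x <-] := f_surj y.
  by change ((f @^-1` K) x -> P (f x)); rewrite eqKP.
by change ((f @^-1` P) x -> K (f x)); rewrite -eqKP.
Qed.

Lemma proper_submodule_preimage K :
  proper_submodule (f @^-1` K) <-> proper_submodule K.
Proof.
split=> -[/submodule_preimage subK neqT]; split=> // eqT; apply: neqT.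
  by rewrite eqT preimage_setT.
by apply: preimage_surj_inj; rewrite preimage_setT.
Qed.

Lemma maximal_submodule_of_preimage K :
  maximal_submodule (f @^-1` K) -> maximal_submodule K.
Proof.
move=> [/proper_submodule_preimage propK maxK]; split=> // P subP leKP.
have [||eqP|eqP] := maxK (f @^-1` P); first exact/submodule_preimage.
- exact: preimage_subset.
- by left; apply: preimage_surj_inj.
- by right; apply: preimage_surj_inj; rewrite preimage_setT.
Qed.

Lemma classical_prime_preimage P :
  classical_prime P -> classical_prime (f @^-1` P).
Proof.
move=> [propP primeP]; split; first exact/proper_submodule_preimage.
by move=> a b m; rewrite /= !linearZ; apply: primeP.
Qed.

Lemma preimage_image_submodule (N : set M) :
  submodule N -> f @^-1` [set 0] `<=` N -> f @^-1` (f @` N) = N.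
Proof.
move=> /submoduleP[_ Nlin] kerN; apply/seteqP; split=> x; last by exists x.
(* Since [f z = f x], the difference [x - z] lies in the kernel, hence in [N]; writing [x] as
   [1 *: (x - z) + z] fits the closure property. *)
move=> [z Nz fzx]; rewrite -(subrK z x) -[x - z]scale1r; apply: Nlin => //.
by apply: kerN; rewrite /= linearB fzx subrr.
Qed.

Lemma cl_Hilbert_surj : cl_Hilbert M -> cl_Hilbert L.
Proof.
move=> hilM P primeP.
have [F maxF eqF] := hilM _ (classical_prime_preimage primeP).
exists [set K | F (f @^-1` K)] => [K /maxF|].
  exact: maximal_submodule_of_preimage.
apply/seteqP; split=> y; have [x <-] := f_surj y.
  by move=> Px K; have : (f @^-1` P) x by []; rewrite eqF; apply.
move=> Fx; change ((f @^-1` P) x); rewrite eqF => N FN.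
have [[subN _] _] := maxF _ FN.
(* Each [N] in [F] contains [f @^-1]
   P[, hence the kernel because]P[contains 0. So]N[is a preimage and]f @[N] belongs to the new
   family. *)
have eqN : f @^-1` (f @` N) = N.
  apply: preimage_image_submodule => // z /= fz0.
  have : (f @^-1` P) z.
    by have [[/submoduleP[P0 _] _] _] := primeP; rewrite /= fz0.
  by rewrite eqF; apply.
by rewrite -eqN; apply: Fx; rewrite /= eqN.
Qed.

End SurjectiveImage.

Section Projection.
Variables (R : comNzRingType) (I : Type) (M : I -> lmodType R) (i : I).

Definition direct_sum_proj (f : direct_sum M) : M i := direct_sum_val f i.

Fact direct_sum_proj_is_linear : linear direct_sum_proj.
Proof. by []. Qed.

HB.instance Definition _ := GRing.isLinear.Build R (direct_sum M) (M i) _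
  direct_sum_proj direct_sum_proj_is_linear.

(** The type [M j] varies with [j], so [x] is transported along [i = j], an equality decided
    classically since [I] is an arbitrary type. *)
Definition single (x : M i) : direct_product M := fun j =>
  if pselect (i = j) is left eq_ij then eq_rect i M x j eq_ij else 0.

Fact single_finitely_supported x : single x \in finitely_supported (M := M).
Proof.
apply/asboolP/(@sub_finite_set _ _ [set i]); last exact: finite_set1.
by move=> j /=; rewrite /single; case: pselect => // ->.
Qed.

Lemma direct_sum_proj_surj y : exists x, direct_sum_proj x = y.
Proof.
exists (DirectSum (single_finitely_supported y)).
rewrite /direct_sum_proj /= /single; case: pselect => // eq_ii.
(* Once the proof of [i = i] is [erefl], the transport reduces to [y]. *)
by rewrite (Prop_irrelevance eq_ii erefl).
Qed.

End Projection.

Theorem corollary2p8 (R : comNzRingType) (I : Type) (M : I -> lmodType R) :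
  cl_Hilbert (direct_sum M) -> forall i : I, cl_Hilbert (M i).
Proof.
move=> hilM i.
exact: (cl_Hilbert_surj (f := @direct_sum_proj R I M i)
          (@direct_sum_proj_surj R I M i)).
Qed.
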